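(* Let $(U,L)$ be a bivariate Lévy process and $\mathcal{A}$ the associated operator (notation as in the context), with $\nu_U(\{-1\})=0$. Let $f$ be a norm-like $C^2$ function on $\mathbb{R}$ such that: $f$ is even; there is $k_f>0$ with $f(x+y)\le k_f+f(x)+f(y)$ for all $x,y\in\mathbb{R}$; $\lim_{x\to\infty}x\sup_{|y|\ge x}|f''(y)|=0$; $\lim_{x\to\infty}f'(x)=0$; and $\int\!\!\int_{\mathbb{R}^2}f(|z|)\,\nu_{UL}(\mathrm{d}z)<\infty$. Put $g(x)=xf'(x)$ and assume that $g$ is positive on $(0,\infty)$, slowly varying at infinity, increasing for $x>x_0$ for some $x_0>0$; that there is $k_g>0$ such that $g(xu)\le k_g\,g(x)g(u)$ for all $u,x\ge1$; that $xf''(x)\sim-f'(x)$ as $x\to\infty$; and that there is a concave function $\varphi$ such that $\varphi(f(x))=g(x)$ for $x$ large enough. Furthermore, assume that $$\int_{|z|>1}g(z)\log|z|\,\nu_U(\mathrm{d}z)<\infty,\qquad \int_{-3/2}^{-1/2}|1+z|^{-\varepsilon}\,\nu_U(\mathrm{d}z)<\infty\ \text{ for some }\varepsilon>0,$$ and $$\gamma_U-\frac{\sigma_U^2}{2}+\int_{\mathbb{R}}\bigl[\log|1+z|-z\,I(|z|\le 1)\bigr]\nu_U(\mathrm{d}z)+\int_{-1}^1 z\,\nu'(\mathrm{d}z)<0.$$ Then the subexponential ergodicity drift condition holds: there exist a norm-like function $F\ge1$, a constant $d>0$, a compact set $C$, and a positive concave function $\Phi$ such that $\mathcal{A}F(x)\le-\Phi(F(x))+d\,I_C(x)$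 for all $x\in\mathbb{R}$.
   Context: $(U_t,L_t)_{t\ge0}$ is a bivariate Lévy process with $$\log \mathbf{E}e^{\mathfrak{i}(\theta_1U_1+\theta_2L_1)}=\mathfrak{i}(\theta_1\gamma_U+\theta_2\gamma_L)-\tfrac12\langle\theta\Sigma,\theta\rangle+\int\!\!\int_{\mathbb{R}^2}\bigl(e^{\mathfrak{i}(\theta_1z_1+\theta_2z_2)}-1-\mathfrak{i}(\theta_1z_1+\theta_2z_2)I(|z|\le1)\bigr)\nu_{UL}(\mathrm{d}z),$$ where $\theta=(\theta_1,\theta_2)$, $z=(z_1,z_2)$, $\gamma_U,\gamma_L\in\mathbb{R}$, $\Sigma=\begin{pmatrix}\sigma_U^2&\sigma_{UL}\\ \sigma_{UL}&\sigma_L^2\end{pmatrix}$ is nonnegative semidefinite, $\nu_{UL}$ is a bivariate Lévy measure, $|\cdot|$ is the Euclidean norm on $\mathbb{R}$ and $\mathbb{R}^2$, and $I(\cdot)$, $I_C$ denote indicators. $\nu_U$ is the Lévy measure of $U$. The finite measure $\nu'$ on $[-1,1]$ is $\nu'(A)=\nu_{UL}((A\times\mathbb{R})\cap\{|z|>1\})$ for Borel $A\subset[-1,1]$. For $f\in C^2$ (twice continuously differentiable) such that the integral below exists, $$\mathcal{A}f(x)=(x\gamma_U+\gamma_L)f'(x)+\tfrac12(x^2\sigma_U^2+2x\sigma_{UL}+\sigma_L^2)f''(x)+\int\!\!\int_{\mathbb{R}^2}\bigl[f(x+xz_1+z_2)-f(x)-f'(x)(xz_1+z_2)I(|z|\le1)\bigr]\nu_{UL}(\mathrm{d}z).$$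 A function $f:\mathbb{R}\to[0,\infty)$ is norm-like if $f(x)\to\infty$ as $|x|\to\infty$. The relation $a(x)\sim b(x)$ means $a(x)/b(x)\to1$. *)

(* Defs.v *)
From HB Require Import structures.
From mathcomp Require Import all_boot all_order all_algebra.
From mathcomp Require Import complex.
From mathcomp Require Import all_classical all_reals all_analysis.
From mathcomp Require Import measurable_realfun.

Set Implicit Arguments.
Unset Strict Implicit.
Unset Printing Implicit Defensive.

Import Order.TTheory GRing.Theory Num.Theory.
Import numFieldNormedType.Exports.

Local Open Scope classical_set_scope.
Local Open Scope ring_scope.

(* The library norm on R * R is the sup norm, hence this definition of the
   Euclidean norm. *)
Definition enorm (R : realType) (z : R * R) : R :=
  Num.sqrt (z.1 ^+ 2 + z.2 ^+ 2).

Definition dot (R : realType) (a z : R * R) : R := a.1 * z.1 + a.2 * z.2.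

Lemma measurable_enorm (R : realType) : measurable_fun setT (@enorm R).
Proof.
apply: measurableT_comp; first by apply: continuous_measurable_fun;
  exact: sqrt_continuous.
by apply: measurable_funD; apply: measurable_funX;
  [exact: measurable_fst | exact: measurable_snd].
Qed.

Section first_marginal.
Context (R : realType) (nu : {measure set (R * R) -> \bar R}).
Context (D : set (R * R)) (mD : measurable D).

(* A |-> nu ((A x R) `&` D) *)
Definition fst_marginal : set R -> \bar R := pushforward (mrestr nu mD) fst.

Let fst_marginal0 : fst_marginal set0 = 0%E.
Proof. by rewrite /fst_marginal /pushforward preimage_set0 measure0. Qed.

Let mfst A : measurable A -> measurable ((@fst R R) @^-1` A).
Proof. by move=> mA; rewrite -[X in measurable X]setTI; exact: measurable_fst. Qed.

Let fst_marginal_ge0 A : (0 <= fst_marginal A)%E.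
Proof. exact: measure_ge0. Qed.

Let fst_marginal_sigma_additive : semi_sigma_additive fst_marginal.
Proof.
move=> F mF tF mUF; rewrite /fst_marginal /pushforward preimage_bigcup.
apply: measure_semi_sigma_additive.
- by move=> n; exact: mfst.
- apply/trivIsetP => /= i j _ _ ij; rewrite -preimage_setI.
  by move/trivIsetP : tF => /(_ _ _ _ _ ij) ->//; rewrite preimage_set0.
- by rewrite -preimage_bigcup; exact: mfst.
Qed.

HB.instance Definition _ := isMeasure.Build _ _ _ fst_marginal
  fst_marginal0 fst_marginal_ge0 fst_marginal_sigma_additive.

End first_marginal.

Lemma measurable_fst_neq0 (R : realType) :
  measurable [set z : R * R | z.1 != 0].
Proof.
rewrite (_ : mkset _ = fst @^-1` (~` [set 0])); last first.
  by apply/seteqP; split=> z /= /eqP.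
rewrite -[X in measurable X]setTI; apply: measurable_fst => //.
exact: measurableC.
Qed.

Lemma measurable_nu'_dom (R : realType) :
  measurable [set z : R * R | z.1 \in `[-1, 1] /\ 1 < enorm z].
Proof.
rewrite (_ : mkset _ = fst @^-1` `[-1, 1] `&` @enorm R @^-1` `]1, +oo[).
  apply: measurableI; rewrite -[X in measurable X]setTI.
    exact: measurable_fst.
  exact: measurable_enorm.
by apply/seteqP; split=> z /=; rewrite !in_itv/= andbT.
Qed.

Record levy_triplet (R : realType) := LevyTriplet {
  gammaU : R;
  gammaL : R;
  sigmaU : R;
  sigmaL : R;
  sigmaUL : R;
  nuUL : {measure set (R * R) -> \bar R} }.

Definition levy_measure (R : realType) (nu : {measure set (R * R) -> \bar R}) :=
  nu [set (0, 0)] = 0%E /\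
  (\int[nu]_z (Num.min 1 (enorm z ^+ 2))%:E < +oo)%E.

Definition covariance_form (R : realType) (tr : levy_triplet R) (a : R * R) : R :=
  a.1 ^+ 2 * sigmaU tr ^+ 2 + 2 * a.1 * a.2 * sigmaUL tr
  + a.2 ^+ 2 * sigmaL tr ^+ 2.

Definition valid_triplet (R : realType) (tr : levy_triplet R) :=
  (forall a, 0 <= covariance_form tr a) /\ levy_measure (nuUL tr).

(* The Levy measure of the first coordinate: the first marginal of nuUL off 0,
   since a Levy measure does not charge 0. *)
Definition nuU (R : realType) (tr : levy_triplet R) :
    {measure set R -> \bar R} :=
  fst_marginal (nuUL tr) (@measurable_fst_neq0 R).

(* The measure A |-> nuUL ((A x R) `&` {|z| > 1}) on [-1, 1], extended by 0 to
   R. *)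
Definition nu' (R : realType) (tr : levy_triplet R) :
    {measure set R -> \bar R} :=
  fst_marginal (nuUL tr) (@measurable_nu'_dom R).

Section levy_process.
Local Open Scope complex_scope.
Context (R : realType).

Definition cexp (z : R[i]) : R[i] :=
  (expR (complex.Re z))%:C * (cos (complex.Im z) +i* sin (complex.Im z)).

Definition cintegral d (T : measurableType d) (mu : {measure set T -> \bar R})
    (h : T -> R[i]) : R[i] :=
  (\int[mu]_w complex.Re (h w)) +i* (\int[mu]_w complex.Im (h w)).

Definition levy_exponent (tr : levy_triplet R) (theta : R * R) : R[i] :=
  'i%C * (theta.1 * gammaU tr + theta.2 * gammaL tr)%:C
  - (covariance_form tr theta / 2)%:C
  + cintegral (nuUL tr) (fun z =>
      cexp ('i%C * (dot theta z)%:C) - 1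
      - 'i%C * (dot theta z * \1_[set y | enorm y <= 1] z)%:C).

Context d (T : measurableType d) (P : probability T R).
(* Only the times t >= 0 are relevant. *)
Implicit Types X : R -> T -> R * R.

Definition independent_increments X :=
  forall (n : nat) (t : nat -> R) (B : nat -> set (R * R)),
    0 <= t 0%N -> (forall i, t i <= t i.+1) -> (forall i, measurable (B i)) ->
    P [set w | forall i, (i < n)%N -> B i (X (t i.+1) w - X (t i) w)] =
    (\prod_(i < n) P [set w | B i (X (t i.+1) w - X (t i) w)%R])%E.

Definition stationary_increments X :=
  forall (s t : R) (B : set (R * R)), 0 <= s -> 0 <= t -> measurable B ->
    P [set w | B (X (s + t) w - X s w)] = P [set w | B (X t w)].

Definition stochastically_continuous X :=
  forall (t e : R), 0 <= t -> 0 < e ->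
    P [set w | e < enorm (X s w - X t w)]
      @[s --> within [set s | 0 <= s] (nbhs t)] --> 0%E.

Definition cadlag (x : R -> R * R) :=
  forall t : R, 0 <= t ->
    x s @[s --> t^'+] --> x t /\ (0 < t -> exists l : R * R, x s @[s --> t^'-] --> l).

Definition levy_process X :=
  [/\ forall t, 0 <= t -> measurable_fun setT (X t),
      {ae P, forall w, X 0 w = (0, 0)},
      independent_increments X,
      stationary_increments X &
      stochastically_continuous X /\ {ae P, forall w, cadlag (X ^~ w)}].

(* U, L is a bivariate Levy process with triplet tr; that log E is the
   exponent is written E = exp (exponent). *)
Definition levy_process_with_triplet (U L : R -> T -> R) (tr : levy_triplet R) :=
  [/\ valid_triplet tr,
      levy_process (fun t w => (U t w, L t w)) &
      forall theta : R * R,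
        cintegral P (fun w => cexp ('i%C * (dot theta (U 1 w, L 1 w))%:C)) =
        cexp (levy_exponent tr theta)].

End levy_process.

Section generator.
Context (R : realType) (tr : levy_triplet R).
Implicit Types f : R -> R.

Definition C2 f :=
  [/\ forall x, derivable f x 1, forall x, derivable (derive1 f) x 1 &
      continuous (derive1n 2 f)].

Definition jump_integrand f (x : R) (z : R * R) : R :=
  f (x + x * z.1 + z.2) - f x
  - derive1 f x * (x * z.1 + z.2) * \1_[set y | enorm y <= 1] z.

Definition in_domain f :=
  C2 f /\ forall x, (nuUL tr).-integrable setT (EFin \o jump_integrand f x).

Definition generator f (x : R) : R :=
  (x * gammaU tr + gammaL tr) * derive1 f x
  + 2^-1 * (x ^+ 2 * sigmaU tr ^+ 2 + 2 * x * sigmaUL tr + sigmaL tr ^+ 2)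
    * derive1n 2 f x
  + \int[nuUL tr]_z jump_integrand f x z.

End generator.

Section functions.
Context (R : realType).
Implicit Types f g : R -> R.

Definition norm_like f :=
  [/\ forall x, 0 <= f x,
      f x @[x --> +oo] --> +oo & f x @[x --> -oo] --> +oo].

Definition slowly_varying g :=
  forall l, 0 < l -> g (l * x) / g x @[x --> +oo] --> (1 : R).

Definition asymp_eq f g := f x / g x @[x --> +oo] --> (1 : R).

Definition concave_function (D : set R) f :=
  convex_function (E := R^o) D (fun x => - f x).

End functions.

Definition subexponential_drift_condition (R : realType) (tr : levy_triplet R) :=
  exists (F Phi : R -> R) (d : R) (C : set R),
    [/\ norm_like F /\ (forall x, 1 <= F x),
        in_domain tr F,
        0 < d /\ compact C,
        (* F takes its values in [1, +oo[ *)
        (forall u, 1 <= u -> 0 < Phi u) /\ concave_function `[1, +oo[ Phi &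
        forall x, generator tr F x <= - Phi (F x) + d * \1_C x].

(* Main.v *)
Require Import Defs.
From HB Require Import structures.
From mathcomp Require Import all_boot all_order all_algebra.
From mathcomp Require Import all_classical all_reals all_analysis.
From mathcomp Require Import measurable_realfun ring lra.

Set Implicit Arguments.
Unset Strict Implicit.
Unset Printing Implicit Defensive.

Import Order.TTheory GRing.Theory Num.Theory.
Import numFieldNormedType.Exports.

Local Open Scope classical_set_scope.
Local Open Scope ring_scope.

(** The witness is F = f + 1; what has to be proved is that, for some c > 0,
    generator f x <= - c * g x as soon as |x| is large.  Indeed g = phi \o f near
    infinity, and translating the argument of phi, which is concave and positive
    near infinity, at most doubles its values there ([concave_double]); hence
    c * g x dominates a positive concave function of F x.  On a compact set both
    the generator ([jump_integral_bound]) and that concave function are bounded,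
    which the constant d absorbs.

    The estimate at infinity rests on the logarithmic behaviour of f.  As
    derive1 f x = g x / x with g slowly varying, (f (x * u) - f x) / g x tends
    to ln u ([f_dilation_cvg]).  Divide the generator by g x: the drift
    contributes gammaU in the limit, the diffusion - sigmaU ^ 2 / 2 because
    x ^ 2 * f'' is equivalent to - g, and the jump integrand converges to
    [jump_limit] z = ln |1 + z.1| - z.1 * (|z| <= 1) at every z with
    z.1 <> -1 ([jump_scaled_cvg]).  The integral of [jump_limit] is the sum of
    the two integrals of the last hypothesis ([Rintegral_jump_limit]): nu'
    accounts for the points with |z.1| <= 1 < |z|, which the compensator of the
    first coordinate counts as small jumps and that of the pair does not.
    Hence the upper limit of generator f x / g x is at most the constant
    assumed to be negative.

    Only an upper bound on the limit of the jump integrals is needed, so the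
    reverse Fatou lemma ([reverse_fatou]) applies with a one-sided domination:
    jump_integrand f x z <= C * g x * [jump_weight] z, where [jump_weight] z is
    min (1, |z| ^ 2) + f |z|, an integrable function ([jump_bound_infty]).
    Small jumps are treated by a Taylor expansion, large ones by the inequality
    f (x * u) - f x <= kg * g x * (f u - f 1), and both estimates come from the
    submultiplicativity of g.  Nothing has to be said from below, in particular
    near z.1 = -1, where the process may jump close to 0 and f drop
    considerably; there one only needs [jump_limit] to be integrable, which
    follows from the assumption on |1 + z| ^ (- eps). *)

(** * Integration *)

Section integration.
Context d (T : measurableType d) (R : realType).
Context (mu : {measure set T -> \bar R}).

Lemma integrable_le (f g : T -> R) : measurable_fun setT f ->
  (forall x, `|f x| <= g x) -> mu.-integrable setT (EFin \o g) ->
  mu.-integrable setT (EFin \o f).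
Proof.
move=> mf fg; apply: le_integrable => //; first exact/measurable_EFinP.
by move=> x _ /=; rewrite lee_fin (le_trans (fg x))// ler_norm.
Qed.

Lemma ge0_integrable (f : T -> R) : measurable_fun setT f ->
  (forall x, 0 <= f x) -> (\int[mu]_x (f x)%:E < +oo)%E ->
  mu.-integrable setT (EFin \o f).
Proof.
move=> mf f0 foo; apply/integrableP; split; first exact/measurable_EFinP.
by under eq_integral do rewrite /= ger0_norm//.
Qed.

(** A measure-theoretic limit is known only off a null set, while the integrals
    of interest are over the whole space. *)
Lemma integral_setC_null (N : set T) (f : T -> R) : measurable N ->
  mu N = 0%E -> mu.-integrable setT (EFin \o f) ->
  (\int[mu]_(x in ~` N) (f x)%:E = (\int[mu]_x f x)%:E)%E.
Proof.
move=> mN N0 intf; rewrite -setTD -(negligible_integral mN)//.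
by rewrite /Rintegral fineK//; exact: integrable_fin_num.
Qed.

Lemma limn_einf_le_cvg (u v : (\bar R)^nat) (l : \bar R) :
  (forall n, u n <= v n)%E -> v @ \oo --> l -> (limn_einf u <= l)%E.
Proof.
move=> uv vl; rewrite limn_einf_lim -(cvg_lim _ vl)//.
apply: lee_lim; [exact: is_cvg_einfs|by apply/cvg_ex; exists l|].
apply: nearW => n; apply: le_trans (uv n).
by apply: ereal_inf_lbound; exists n => /=.
Qed.

(** Fatou's lemma for the nonnegative functions W - h n.  The lower bounds [r]
    stand for the integrals of the h n, which need not converge. *)
Lemma reverse_fatou (N : set T) (W l : T -> R) (h : nat -> T -> R)
    (r : nat -> R) (r0 : R) :
  measurable N -> mu N = 0%E ->
  mu.-integrable setT (EFin \o W) -> mu.-integrable setT (EFin \o l) ->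
  (forall n, mu.-integrable setT (EFin \o h n)) ->
  (forall n x, h n x <= W x) ->
  (forall x, ~ N x -> h n x @[n --> \oo] --> l x) ->
  (forall n, r n <= \int[mu]_x h n x) -> r n @[n --> \oo] --> r0 ->
  r0 <= \int[mu]_x l x.
Proof.
move=> mN N0 intW intl inth hW hl rh rr0.
have intB k : mu.-integrable setT (EFin \o k) ->
    mu.-integrable setT (EFin \o (fun x => W x - k x)).
  by move=> intk; exact: (integrableB measurableT intW intk).
have mB n : measurable_fun (~` N) (fun x => (W x - h n x)%:E).
  by apply: measurable_funTS; have /integrableP[] := intB _ (inth n).
have := @fatou _ _ _ mu _ (measurableC mN) _ mB.
move=> /(_ _)/wrap[n x _|]; first by rewrite lee_fin subr_ge0.
under eq_integral => x.
  rewrite inE => Nx.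
  have Wl : (W x - h n x)%:E @[n --> \oo] --> (W x - l x)%:E.
    apply: cvg_EFin; first by near=> n.
    by apply: cvgB; [exact: cvg_cst|exact: hl].
  rewrite (cvg_limn_einf_sup Wl).1; over.
rewrite integral_setC_null//; last exact: intB.
move=> /le_trans => /(_ (\int[mu]_x W x - r0)%:E).
rewrite lee_fin RintegralB// lerD2l lerN2; apply.
apply: (@limn_einf_le_cvg _ (fun n => (\int[mu]_x W x - r n)%:E)).
  move=> n; rewrite integral_setC_null//; last exact: intB.
  by rewrite RintegralB// lee_fin lerD2l lerN2.
apply: cvg_EFin; first by near=> n.
by apply: cvgB => //; exact: cvg_cst.
Unshelve. all: by end_near. Qed.

End integration.

Section first_marginal_integral.
Context (R : realType) (nu : {measure set (R * R) -> \bar R}).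
Context (D : set (R * R)) (mD : measurable D).
Local Open Scope ereal_scope.

Lemma ge0_integral_fst_marginal (A : set R) (h : R -> \bar R) :
  measurable A -> measurable_fun setT h -> (forall t, 0 <= h t) ->
  \int[fst_marginal nu mD]_(t in A) h t =
  \int[nu]_(z in D `&` fst @^-1` A) h z.1.
Proof.
move=> mA mh h0.
have mfstA : measurable (fst @^-1` A : set (R * R)).
  by rewrite -[X in measurable X]setTI; exact: measurable_fst.
have mhfst (E : set (R * R)) : measurable_fun E (h \o fst).
  apply: measurable_funTS; apply: measurableT_comp mh _.
  exact: measurable_fst.
(* [fst_marginal] and [pushforward] carry distinct measure structures on the
   same set function. *)
transitivity (\int[pushforward (mrestr nu mD) fst]_(t in A) h t).
  by apply: eq_measure_integral.
rewrite ge0_integral_pushforward//=; last exact: measurable_funTS.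
rewrite (@ge0_negligible_integral _ _ _ _ _ (~` D))//; last 2 first.
- exact: measurableC.
- by rewrite /= /mrestr setICl measure0.
rewrite setDE setCK setIC.
apply: eq_measure_integral => B mB BD.
rewrite /= /mrestr setIidl// => z /BD[]//.
Qed.

Lemma integral_fst_marginal (A : set R) (h : R -> \bar R) :
  measurable A -> measurable_fun setT h ->
  \int[fst_marginal nu mD]_(t in A) h t =
  \int[nu]_(z in D `&` fst @^-1` A) h z.1.
Proof.
move=> mA mh; rewrite integralE [RHS](integralE _ _ (h \o fst)).
rewrite [(h \o fst)^\+]funepos_comp [(h \o fst)^\-]funeneg_comp.
by rewrite !ge0_integral_fst_marginal//;
  [exact: measurable_funeneg|exact: measurable_funepos].
Qed.

End first_marginal_integral.

(** * Calculus *)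

Section calculus.
Context (R : realType).
Implicit Types f : R -> R.

Lemma is_derive_continuous f (df : R -> R) :
  (forall x : R, is_derive x 1 f (df x)) -> continuous f.
Proof.
move=> fdf x; apply/differentiable_continuous/derivable1_diffP.
by have := fdf x.
Qed.

Lemma mean_value f (df : R -> R) (a b : R) :
  (forall x : R, is_derive x 1 f (df x)) ->
  exists2 c, Num.min a b <= c <= Num.max a b & f b - f a = df c * (b - a).
Proof.
move=> fdf.
have cf := is_derive_continuous fdf.
have [ab|/ltW ba] := leP a b.
- have [c] := MVT_segment ab (fun x _ => fdf x) (continuous_subspaceT cf).
  by rewrite in_itv/= => ? ?; exists c.
- have [c] := MVT_segment ba (fun x _ => fdf x) (continuous_subspaceT cf).
  rewrite in_itv/= => cab fE; exists c => //.
  by rewrite -opprB fE -mulrN opprB.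
Qed.

Lemma C2_derivable f : C2 f -> forall x : R, derivable f x 1.
Proof. by case=> df _ _; exact: df. Qed.

Lemma C2_is_derive f : C2 f -> forall x : R, is_derive x 1 f (derive1 f x).
Proof. by move=> [df _ _] x; rewrite derive1E; exact/derivableP. Qed.

Lemma C2_is_derive2 f : C2 f ->
  forall x : R, is_derive x 1 (derive1 f) (derive1n 2 f x).
Proof. by move=> [_ df _] x; rewrite /= derive1E; exact/derivableP. Qed.

Lemma C2_continuous f : C2 f -> continuous f.
Proof. by move=> /C2_is_derive/is_derive_continuous. Qed.

Lemma C2_continuous1 f : C2 f -> continuous (derive1 f).
Proof. by move=> /C2_is_derive2/is_derive_continuous. Qed.

Lemma C2_continuous2 f : C2 f -> continuous (derive1n 2 f).
Proof. by case=> _ _ c2; exact: c2. Qed.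

Lemma is_derive_mull f (k x df : R) : is_derive x 1 f df ->
  is_derive x 1 (fun y => k * f y) (k * df).
Proof. exact: (@is_deriveZ _ _ _ f k x 1 df). Qed.

Lemma norm_between0 (a s : R) :
  Num.min 0 a <= s <= Num.max 0 a -> `|s| <= `|a|.
Proof.
move: (ler_norm a) (ler_norm (- a)); rewrite normrN ler_norml.
by case: (leP 0 a) => ? ? ? /andP[? ?]; apply/andP; split; lra.
Qed.

Lemma taylor2_bound f (B x h : R) : C2 f ->
  (forall y, `|y - x| <= `|h| -> `|derive1n 2 f y| <= B) ->
  `|f (x + h) - f x - derive1 f x * h| <= B * h ^+ 2.
Proof.
move=> C2f fB.
have [c cx ->] := mean_value x (x + h) (C2_is_derive C2f).
have ch : `|c - x| <= `|h|.
  rewrite ler_norml; move: cx (ler_norm h) (ler_norm (- h)); rewrite normrN.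
  by case: (leP x (x + h)) => ? /andP[]; lra.
rewrite (_ : x + h - x = h); last by ring.
have [e ex] := mean_value x c (C2_is_derive2 C2f).
rewrite -mulrBl => ->; rewrite !normrM.
have eh : `|e - x| <= `|h|.
  move: ch; rewrite !ler_norml; move: ex (ler_norm h) (ler_norm (- h)).
  by rewrite normrN; case: (leP x c) => ? /andP[? ?] ? ? /andP[]; lra.
have B0 := fB _ eh; have B1 : 0 <= `|derive1n 2 f e| by [].
rewrite -(real_normK (num_real h)) expr2 mulrA ler_wpM2r// ler_pM//.
Qed.

Lemma bounded_on_segment f (M : R) : continuous f ->
  exists2 B, 0 < B & forall x, `|x| <= M -> `|f x| <= B.
Proof.
move=> cf; have [M0|M0] := ltP M 0.
  by exists 1 => // x; have := normr_ge0 x; lra.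
have cnf : {within `[- M, M], continuous (fun x => `|f x|)}.
  by apply: continuous_subspaceT => x; apply: cvg_norm; exact: cf.
have [|c _ fc] := EVT_max _ cnf; first by lra.
exists (`|f c| + 1); first by rewrite ltr_wpDl.
move=> x xM; rewrite (le_trans (fc x _)) ?lerDl//.
by rewrite in_itv/= -ler_norml.
Qed.

Lemma derive1_comp_opp f x : (forall x, derivable f x 1) ->
  derive1 (f \o -%R) x = - derive1 f (- x).
Proof.
move=> df; rewrite derive1_comp//.
have -> : derive1 -%R x = -1 :> R by rewrite (@derive1N _ id) ?derive1_id.
by rewrite mulrN1.
Qed.

Lemma derive1_even f : (forall x, derivable f x 1) ->
  (forall x, f (- x) = f x) -> forall x, derive1 f (- x) = - derive1 f x.
Proof.
move=> df fN x; rewrite -[LHS]opprK -(derive1_comp_opp _ df).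
by rewrite (_ : f \o -%R = f)//; apply/funext => y; exact: fN.
Qed.

Lemma derive1_odd f : (forall x, derivable f x 1) ->
  (forall x, f (- x) = - f x) -> forall x, derive1 f (- x) = derive1 f x.
Proof.
move=> df fN x; rewrite -[LHS]opprK -(derive1_comp_opp _ df).
rewrite (_ : f \o -%R = - f); last by apply/funext => y /=; rewrite fN.
by rewrite derive1N// opprK.
Qed.

Lemma div_cvg0 (a : nat -> R) (k : R) : (forall n, 0 < `|a n|) ->
  `|a n| @[n --> \oo] --> +oo -> k / a n @[n --> \oo] --> (0 : R).
Proof.
move=> a_gt0 aoo.
have aV0 : `|a n|^-1 @[n --> \oo] --> (0 : R).
  by apply/gtr0_cvgV0 => //; exact: nearW.
have aV1 : (a n)^-1 @[n --> \oo] --> (0 : R).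
  apply/norm_cvg0P; have -> : (fun n => `|(a n)^-1|) = (fun n => `|a n|^-1).
    by apply/funext => n; rewrite normfV.
  exact: aV0.
by have := cvgM (cvg_cst k) aV1; rewrite mulr0; exact.
Qed.

End calculus.

Section concave_functions.
Context (R : realType).

Lemma concave_functionP (D : set R) (phi : R -> R) :
  concave_function D phi <-> forall t x y, 0 <= t <= 1 -> D x -> D y ->
    t * phi x + (1 - t) * phi y <= phi (t * x + (1 - t) * y).
Proof.
split=> [cphi t x y /andP[t0 t1] Dx Dy|cphi t x y].
  have /(_ x y) := cphi (Itv01 t0 t1); rewrite !inE => /(_ Dx Dy).
  rewrite [leRHS](_ : _ = - (t * phi x + (1 - t) * phi y)) ?lerN2//.
  by rewrite opprD -!mulrN.
rewrite !inE => Dx Dy; rewrite convRE !mulrN -opprD lerN2.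
by apply: cphi => //; apply/andP; split; [exact: ge0|exact: le1].
Qed.

Lemma concave_translate (K : R) (phi : R -> R) : 0 <= K ->
  concave_function `[0, +oo[ phi ->
  forall c, 0 <= c -> concave_function `[1, +oo[ (fun u => c * phi (u + K)).
Proof.
move=> K0 /concave_functionP cphi c c0; apply/concave_functionP => t x y t01 /=.
rewrite !in_itv/= !andbT => x1 y1.
rewrite mulrCA [(1 - t) * _]mulrCA -mulrDr ler_wpM2l//.
rewrite (_ : t * x + _ + K = t * (x + K) + (1 - t) * (y + K)); last by ring.
by apply: cphi => //=; rewrite in_itv/= andbT; lra.
Qed.

(** Concavity at v, the midpoint of v - a and v + a. *)
Lemma concave_double (phi : R -> R) (v a : R) :
  concave_function `[0, +oo[ phi ->
  0 <= a <= v -> 0 <= phi (v - a) -> phi (v + a) <= 2 * phi v.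
Proof.
move=> /concave_functionP cphi /andP[a0 av] phi0.
have := cphi (1 / 2) (v - a) (v + a).
rewrite (_ : _ * (v - a) + _ = v) => [/(_ _ _ _)/wrap[|||]|]; last by field.
- by apply/andP; split; lra.
- by rewrite /= in_itv/= andbT; lra.
- by rewrite /= in_itv/= andbT; lra.
- by move: phi0; lra.
Qed.

End concave_functions.

Section adding_a_constant.
Context (R : realType) (f : R -> R) (c : R).
Hypothesis C2f : C2 f.

Lemma derive1_addc : derive1 (fun x => f x + c) = derive1 f.
Proof.
apply/funext => x; rewrite !derive1E.
have dfx := @C2_derivable _ _ C2f x.
by rewrite deriveD// derive_cst addr0.
Qed.

Lemma C2_addc : C2 (fun x => f x + c).
Proof.
have [df d2f cf] := C2f; split.
- by move=> x; apply: derivableD => //; exact: df.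
- by rewrite derive1_addc.
- by rewrite /= derive1_addc.
Qed.

Lemma jump_integrand_addc :
  jump_integrand (fun x => f x + c) = jump_integrand f.
Proof.
apply/funext => x; apply/funext => z.
by rewrite /jump_integrand derive1_addc; congr (_ - _); ring.
Qed.

Lemma generator_addc (tr : levy_triplet R) :
  generator tr (fun x => f x + c) = generator tr f.
Proof.
by apply/funext => x; rewrite /generator jump_integrand_addc /= derive1_addc.
Qed.

Lemma norm_like_addc : 0 <= c -> norm_like f -> norm_like (fun x => f x + c).
Proof.
move=> c0 [f0 fy fNy]; split=> [x||]; first by rewrite addr_ge0.
- by apply: (@ger_cvgy _ _ _ _ f) => //; apply: nearW => x; rewrite lerDl.
- by apply: (@ger_cvgy _ _ _ _ f) => //; apply: nearW => x; rewrite lerDl.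
Qed.

End adding_a_constant.

(** * Jumps *)

Section jumps.
Context (R : realType).
Implicit Types (z : R * R) (f : R -> R).

Lemma enorm_ge0 z : 0 <= enorm z.
Proof. exact: sqrtr_ge0. Qed.

Lemma fst_le_enorm z : `|z.1| <= enorm z.
Proof. by rewrite -sqrtr_sqr ler_wsqrtr// lerDl sqr_ge0. Qed.

Lemma snd_le_enorm z : `|z.2| <= enorm z.
Proof. by rewrite -sqrtr_sqr ler_wsqrtr// lerDr sqr_ge0. Qed.

Lemma displacement_le x z : `|x * z.1 + z.2| <= (`|x| + 1) * enorm z.
Proof.
rewrite (le_trans (ler_normD _ _))// normrM mulrDl mul1r lerD ?snd_le_enorm//.
by rewrite ler_wpM2l// fst_le_enorm.
Qed.

Lemma indic_ball z : \1_[set y | enorm y <= 1] z = (enorm z <= 1)%R%:R :> R.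
Proof.
rewrite indicE; congr (_%:R); congr nat_of_bool.
by apply/idP/idP; rewrite inE.
Qed.

Lemma jump_integrandE f (x : R) z : jump_integrand f x z =
  f (x + (x * z.1 + z.2)) - f x
  - derive1 f x * (x * z.1 + z.2) * (enorm z <= 1)%R%:R.
Proof. by rewrite /jump_integrand indic_ball addrA. Qed.

(** The limit of jump_integrand f x z / g x as |x| tends to infinity. *)
Definition jump_limit (z : R * R) : R :=
  ln `|1 + z.1| - z.1 * (enorm z <= 1)%R%:R.

(** The compensated logarithm that is integrated against [nuU]. *)
Definition log_jump (t : R) : R := ln `|1 + t| - t * (`|t| <= 1)%R%:R.

Lemma measurable_log_jump : measurable_fun setT log_jump.
Proof.
apply: measurable_funB.
  apply: measurableT_comp; first exact: measurable_ln.
  by apply: measurableT_comp => //; apply: measurable_funD.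
apply: measurable_funM => //.
rewrite (_ : (fun t => _) = \1_(`[-1, 1]%classic)); last first.
  apply/funext => t; rewrite indicE; congr (_%:R); congr nat_of_bool.
  by apply/idP/idP; rewrite inE/= in_itv/= ler_norml.
exact: measurable_indic.
Qed.

(** What the compensator of the first coordinate subtracts in excess of that of
    the pair; its integral is the one against nu'. *)
Definition oblique_jump (z : R * R) : R :=
  (fst \_ [set z : R * R | z.1 \in `[-1, 1] /\ 1 < enorm z]) z.

Lemma jump_limit_split z : jump_limit z = log_jump z.1 + oblique_jump z.
Proof.
rewrite /jump_limit /log_jump /oblique_jump patchE.
rewrite -addrA; congr (_ + _).
have [z1|z1] := leP (enorm z) 1.
  rewrite memNset/=; last by case=> _; rewrite ltNge z1.
  by rewrite (le_trans (fst_le_enorm z) z1) addr0.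
case: ifPn => [|].
  rewrite inE/= in_itv/= -ler_norml => -[-> _].
  by rewrite mulr0 mulr1 oppr0 addNr.
rewrite notin_setE/= in_itv/= -ler_norml => zN.
by have [z2|z2] := leP `|z.1| 1; [case: zN|rewrite !mulr0 addr0].
Qed.

Lemma norm_ln1D_sub_le (t : R) : `|t| <= 1 / 2 ->
  `|ln `|1 + t| - t| <= 2 * t ^+ 2.
Proof.
rewrite ler_norml => /andP[t1 t2].
have t0 : 0 < 1 + t by lra.
rewrite (gtr0_norm t0).
have up : ln (1 + t) <= t by apply: le_ln1Dx; lra.
(* the same inequality at - t / (1 + t), as ln (1 + t) = - ln (1 + t)^-1 *)
have inv : (1 + t)^-1 = 1 + - (t / (1 + t)) by field; lra.
have lo : t / (1 + t) <= ln (1 + t).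
  rewrite -lerN2 -lnV ?posrE// [X in ln X]inv; apply: le_ln1Dx.
  by rewrite ltrNl opprK ltr_pdivrMr//; lra.
have tE : t / (1 + t) = t - t ^+ 2 / (1 + t) by field; lra.
have t2le : t ^+ 2 / (1 + t) <= 2 * t ^+ 2.
  rewrite ler_pdivrMr// -subr_ge0.
  rewrite [leRHS](_ : _ = t ^+ 2 * (1 + 2 * t)); last by ring.
  by rewrite mulr_ge0 ?sqr_ge0//; lra.
have := sqr_ge0 t; rewrite ler_norml => t20; apply/andP; split; lra.
Qed.

Definition near_minus1_weight (e : R) (z : R * R) : R :=
  ((fun z : R * R => `|1 + z.1| `^ (- e)) \_
    (fst @^-1` `[(- (3 / 2)), (- (1 / 2))])) z.

Lemma near_minus1_weight_ge0 e z : 0 <= near_minus1_weight e z.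
Proof.
by rewrite /near_minus1_weight patchE; case: ifP => // _; exact: powR_ge0.
Qed.

(** With v = |1 + z.1| < 1, this is e * (- ln v) <= expR (e * (- ln v)).  At
    v = 0 both sides vanish, as ln 0 = 0 and 0 `^ (- e) = 0. *)
Lemma ln_near_minus1 (e : R) z : 0 < e -> `|1 + z.1| < 1 / 2 ->
  `|ln `|1 + z.1| | <= e^-1 * near_minus1_weight e z.
Proof.
move=> e0 z1; rewrite /near_minus1_weight patchE mem_set/=; last first.
  rewrite in_itv/=; move: z1; rewrite ltr_norml => /andP[? ?].
  by apply/andP; split; lra.
rewrite ler_pdivlMl//; set v := `|1 + z.1|.
have v0 : 0 <= v by exact: normr_ge0.
have [->|vN0] := eqVneq v 0; first by rewrite ln0// normr0 mulr0 powR_ge0.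
rewrite /powR (negbTE vN0) ler0_norm; last by rewrite ln_le0//; rewrite /v; lra.
by rewrite mulrN -mulNr (le_trans _ (expR_ge1Dx _))// lerDr.
Qed.

End jumps.

(** * Functions of logarithmic growth *)

Section logarithmic_growth.
Context (R : realType) (f : R -> R) (kf : R).
Hypothesis f_ge0 : forall x, 0 <= f x.
Hypothesis C2f : C2 f.
Hypothesis kf_gt0 : 0 < kf.
Hypothesis f_even : forall x, f (- x) = f x.
Hypothesis f_subadd : forall x y, f (x + y) <= kf + f x + f y.
Let g x := x * derive1 f x.
Hypothesis g_gt0 : forall x : R, 0 < x -> 0 < g x.

Lemma f_abs x : f `|x| = f x.
Proof. by case: ger0P. Qed.

Lemma g_abs x : g `|x| = g x.
Proof.
case: ger0P => // x0.
by rewrite /g (derive1_even (C2_derivable C2f) f_even) mulrNN.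
Qed.

Lemma g_ge0 x : 0 <= g x.
Proof.
rewrite -g_abs; have [->|x0] := eqVneq x 0; first by rewrite normr0 /g mul0r.
by rewrite ltW// g_gt0// normr_gt0.
Qed.

Lemma derive2_abs x : derive1n 2 f `|x| = derive1n 2 f x.
Proof.
have f1_odd := derive1_even (C2_derivable C2f) f_even.
have [_ df1 _] := C2f.
case: ger0P => [_|_]; first by [].
exact: (derive1_odd df1 f1_odd).
Qed.

Lemma f_le_abs x y : `|x| <= `|y| -> f x <= f y.
Proof.
move=> xy; rewrite -f_abs -(f_abs y).
have [c cxy fxy] := mean_value `|x| `|y| (C2_is_derive C2f).
rewrite -subr_ge0 fxy; have [->|cN0] := eqVneq c 0.
  have := derive1_even (C2_derivable C2f) f_even 0; rewrite oppr0 => d0.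
  by have -> : derive1 f 0 = 0 by lra.
have c0 : 0 < c.
  rewrite lt_neqAle eq_sym cN0; move: cxy; rewrite (min_idPl xy) => /andP[].
  by have := normr_ge0 x; lra.
by rewrite mulr_ge0 ?subr_ge0// -(pmulr_rge0 _ c0) -/(g c) ltW// g_gt0.
Qed.

Lemma f_le_scale n u : f (n.+1%:R * u) <= n.+1%:R * (kf + f u).
Proof.
elim: n => [|n ih]; first by rewrite !mul1r lerDr ltW.
rewrite -addn1 natrD !mulrDl !mul1r.
have := f_subadd (n.+1%:R * u) u; lra.
Qed.

Lemma f_increment x h : `|f (x + h) - f x| <= kf + f h.
Proof.
have := f_subadd x h; have := f_subadd (x + h) (- h).
by rewrite addrK f_even ler_norml => ? ?; apply/andP; split; lra.
Qed.

(** The mean value theorem for s |-> f (x * expR s), whose derivative is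
    g (x * expR s). *)
Lemma f_dilation_increment (x u : R) : 0 < x -> 0 < u ->
  exists2 s, Num.min 0 (ln u) <= s <= Num.max 0 (ln u) &
    f (x * u) - f x = g (x * expR s) * ln u.
Proof.
move=> x0 u0.
have dF (s : R) :
    is_derive s 1 (fun s => f (x * expR s)) (g (x * expR s)).
  rewrite /g; have -> : x * expR s * derive1 f (x * expR s) =
    derive1 f (x * expR s) * (x * expR s) by rewrite mulrC.
  by apply: (@is_derive1_comp _ f (fun s => x * expR s)); exact: C2_is_derive.
have [s s0u] := mean_value 0 (ln u) dF.
by rewrite expR0 mulr1 subr0 lnK ?posrE// => ?; exists s.
Qed.

Variable kg : R.
Hypothesis g_submul :
  forall u x : R, 1 <= u -> 1 <= x -> g (x * u) <= kg * g x * g u.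

(** In the variable u, the derivative of the left-hand side is g (x * u) / u
    and that of the right-hand side kg * g x * g u / u. *)
Lemma f_dilation_le (x u : R) : 1 <= x -> 1 <= u ->
  f (x * u) - f x <= kg * g x * (f u - f 1).
Proof.
move=> x1 u1.
have dD (v : R) : is_derive v 1 (fun v => kg * g x * f v - f (x * v))
    (kg * g x * derive1 f v - derive1 f (x * v) * x).
  apply: is_deriveB.
    exact/is_derive_mull/C2_is_derive.
  apply: (@is_derive1_comp _ f (fun s => x * s) v _ x).
    exact: C2_is_derive.
  have := is_derive_mull x (is_derive_id v (1 : R)).
  by rewrite mulr1.
have [c] := mean_value 1 u dD; rewrite (min_idPl u1) (max_idPr u1) mulr1.
move=> /andP[c1 cu] DE.
suff : 0 <= (kg * g x * derive1 f c - derive1 f (x * c) * x) * (u - 1) by lra.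
rewrite mulr_ge0 ?subr_ge0//.
have c0 : 0 < c by lra.
rewrite -(ler_pM2l c0); have := g_submul c1 x1; rewrite /g; lra.
Qed.

Variable x0 : R.
Hypothesis x0_gt0 : 0 < x0.
Hypothesis g_ndecr : forall x y : R, x0 < x -> x <= y -> g x <= g y.

(** g is bounded below by a positive constant near infinity, and f u grows like
    the integral of g t / t. *)
Lemma ln_le_f : exists2 C, 0 < C & forall u, 1 <= u -> `|ln u| <= C * (1 + f u).
Proof.
pose x1 := x0 + 1; have x1_gt0 : 0 < x1 by exact: addr_gt0.
have x0x1 : x0 < x1 by rewrite ltrDl.
have g1 := g_gt0 x1_gt0.
exists (`|ln x1| + (g x1)^-1); first by rewrite ltr_wpDl ?invr_gt0.
move=> u u1; rewrite ger0_norm ?ln_ge0//.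
have u0 : 0 < u by lra.
have fu := f_ge0 u; have gV : 0 < (g x1)^-1 by rewrite invr_gt0.
have [ux1|x1u] := leP u x1.
  apply: (@le_trans _ _ (`|ln x1| * 1)); last first.
    by rewrite ler_pM// ?lerDl ?lerDr// ltW.
  by rewrite mulr1 (le_trans _ (ler_norm _))// ler_ln.
pose v := u / x1; have v1 : 1 <= v by rewrite ler_pdivlMr// mul1r ltW.
have v0 : 0 < v by lra.
have uE : u = x1 * v by rewrite mulrC divfK// gt_eqF.
have lnv := ln_ge0 v1.
have [s] := f_dilation_increment x1_gt0 v0.
rewrite (min_idPl lnv) (max_idPr lnv) -uE => /andP[s0 _] fE.
have gs : g x1 <= g (x1 * expR s).
  apply: g_ndecr => //; rewrite ler_peMr ?(ltW x1_gt0)// -expR0.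
  by rewrite ler_expR.
have lnvf : ln v <= (g x1)^-1 * f u.
  rewrite ler_pdivlMl//; apply: (@le_trans _ _ (g (x1 * expR s) * ln v)).
    exact: ler_wpM2r.
  by rewrite -fE; have := f_ge0 x1; lra.
rewrite uE lnM ?posrE// -uE mulrDl.
have := ler_norm (ln x1); have : 0 <= `|ln x1| * f u by rewrite mulr_ge0.
lra.
Qed.

(** By [f_dilation_increment] the quotient is ln (u t) times the ratio
    g (x t * expR s) / g (x t) with s bounded by B; since g is monotone, that
    ratio lies between two ratios with the fixed dilations expR (- B) and
    expR B, so pointwise slow variation is enough. *)
Lemma f_dilation_cvg T (F : set_system T) {FF : Filter F}
    (x u : T -> R) (u0 : R) :
  slowly_varying g -> 0 < u0 -> x @ F --> +oo -> u @ F --> u0 ->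
  (f (x t * u t) - f (x t)) / g (x t) @[t --> F] --> ln u0.
Proof.
move=> g_sv u0_gt0 xoo uu0; pose B := `|ln u0| + 1.
have lnu : ln (u t) @[t --> F] --> ln u0.
  by apply: continuous_cvg => //; exact: continuous_ln.
have gl l : 0 < l -> g (l * x t) / g (x t) @[t --> F] --> (1 : R).
  by move=> /g_sv; exact: (cvg_comp x (fun y => g (l * y) / g y) xoo).
have p1 := gl _ (expR_gt0 B); have q1 := gl _ (expR_gt0 (- B)).
set p := (fun t => _) in p1; set q := (fun t => _) in q1.
pose E t := B * (`|p t - 1| + `|q t - 1|).
have E0 : E t @[t --> F] --> 0.
  have norm_sub1 h : h @ F --> (1 : R) -> `|h t - 1| @[t --> F] --> (0 : R).
    move=> h1; apply/norm_cvg0P; rewrite -(subrr 1).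
    by apply: cvgB => //; exact: cvg_cst.
  have := cvgM (cvg_cst B) (cvgD (norm_sub1 p p1) (norm_sub1 q q1)).
  by rewrite addr0 mulr0; exact.
rewrite -[ln u0]add0r; rewrite [X in X @ _ --> _](_ : _ = (fun t =>
    ((f (x t * u t) - f (x t)) / g (x t) - ln (u t)) + ln (u t))); last first.
  by apply/funext => t; rewrite subrK.
apply: cvgD => //.
apply: (@squeeze_cvgr _ _ _ _ (fun t => - E t) E) => //; last first.
  by rewrite -oppr0; exact: cvgN.
near=> t.
rewrite -ler_norml.
have xt : 0 < x t by near: t; exact: (cvgryPgt _).1.
have ut : 0 < u t.
  by near: t; exact: (cvgr_gt _ uu0).
have lnB : `|ln (u t)| <= B.
  by near: t; apply: (cvgr_norm_le _ lnu); rewrite ltrDl.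
have xB : x0 < expR (- B) * x t.
  rewrite expRN mulrC ltr_pdivlMr ?expR_gt0//.
  by near: t; exact: (cvgryPgt _).1.
have [s su ->] := f_dilation_increment xt ut.
have gx := g_gt0 xt.
rewrite mulrAC -{2}(mul1r (ln (u t))) -mulrBl normrM mulrC /E ler_pM//.
have sB : `|s| <= B by apply: le_trans lnB; exact: norm_between0.
have : q t <= g (x t * expR s) / g (x t) <= p t.
  rewrite /p /q !ler_pM2r ?invr_gt0//.
  rewrite ler_norml in sB; case/andP: sB => s1 s2.
  have q1' : expR (- B) * x t <= x t * expR s.
    by rewrite mulrC ler_pM2l// ler_expR.
  apply/andP; split; first exact: g_ndecr.
  apply: g_ndecr; first exact: lt_le_trans q1'.
  by rewrite mulrC ler_pM2r// ler_expR.
set r := g (x t * expR s) / _ => /andP[qr rp].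
have [r1|r1] := leP 1 r.
  rewrite (@le_trans _ _ `|p t - 1|) ?lerDl//; rewrite !ger0_norm; lra.
rewrite (@le_trans _ _ `|q t - 1|) ?lerDr//; rewrite !ltr0_norm; lra.
Unshelve. all: by end_near. Qed.

Hypothesis f'_asymp :
  asymp_eq (fun x => x * derive1n 2 f x) (fun x => - derive1 f x).

Lemma f2_scaled_cvg : x ^+ 2 * derive1n 2 f x / g x @[x --> +oo] --> (-1 : R).
Proof.
apply: cvg_trans (cvgN f'_asymp).
apply: near_eq_cvg; near=> x.
have x0' : 0 < x by near: x; apply: nbhs_pinfty_gt; exact: num_real.
have f'x0 : derive1 f x != 0.
  by apply: contraTneq (g_gt0 x0') => f'x0; rewrite /g f'x0 mulr0 ltxx.
rewrite -[LHS]/(- (x * derive1n 2 f x / - derive1 f x)) /g.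
by field; rewrite f'x0 gt_eqF.
Unshelve. all: by end_near. Qed.

Hypothesis kg_gt0 : 0 < kg.
Hypothesis f'_cvg0 : derive1 f x @[x --> +oo] --> (0 : R).

Lemma g_le_sqr : exists2 K, 0 < K & forall u, 1 <= u -> g u <= K * u ^+ 2.
Proof.
have [U [_ fU]] : \forall u \near +oo, `|derive1 f u| <= 1.
  by apply: (cvgr_norm_le _ f'_cvg0); rewrite normr0.
have [B B0 fB] := bounded_on_segment U (C2_continuous1 C2f).
exists (B + 1); first by rewrite addr_gt0.
move=> u u1; have u0 : 0 < u by rewrite (lt_le_trans _ u1).
have fu : derive1 f u <= B + 1.
  rewrite (le_trans (ler_norm _))//.
  have [uU|/fU/= ?] := leP u U; last by rewrite ler_wpDl ?(ltW B0).
  by rewrite ler_wpDr// fB// gtr0_norm.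
rewrite /g mulrC (le_trans (ler_wpM2r (ltW u0) fu))// ler_pM2l ?addr_gt0//.
by rewrite expr2 ler_peMr// ltW.
Qed.

(** With |y| = v * u, v = x / 4 and u >= 1, the equivalence of y ^ 2 * f'' y and
    - g y reduces the claim to g (v * u) <= C * g x * u ^ 2, which is
    submultiplicativity together with [g_le_sqr]. *)
Lemma f2_dilation_bound : exists2 C, 0 < C & \forall x \near +oo,
  forall y, x / 4 <= `|y| -> `|derive1n 2 f y| * x ^+ 2 <= C * g x.
Proof.
have [K K0 gK] := g_le_sqr.
have [Y [_ fY]] : \forall x \near +oo, `|x ^+ 2 * derive1n 2 f x / g x| <= 2.
  by apply: (cvgr_norm_le _ f2_scaled_cvg); rewrite normrN normr1 ltr1n.
exists (32 * kg * K); first by rewrite !mulr_gt0.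
near=> x => y xy; rewrite -derive2_abs.
have x4 : 4 <= x by near: x; exact: nbhs_pinfty_ge.
have xY : Y < x / 4.
  by rewrite ltr_pdivlMr//; near: x; apply: nbhs_pinfty_gt; exact: num_real.
have xx0 : x0 < x / 4.
  by rewrite ltr_pdivlMr//; near: x; apply: nbhs_pinfty_gt; exact: num_real.
set v := x / 4 in xy xY xx0.
have xE : x = v * 4 by rewrite /v divfK.
have v1 : 1 <= v by rewrite /v ler_pdivlMr// mul1r.
have v0 : 0 < v by rewrite (lt_le_trans _ v1).
move: xy; set w := `|y| => vw; pose u := w / v.
have u1 : 1 <= u by rewrite /u ler_pdivlMr// mul1r.
have u0 : 0 < u by rewrite (lt_le_trans _ u1).
have wE : w = v * u by rewrite mulrC divfK// gt_eqF.
have w0 : 0 < w by rewrite wE mulr_gt0.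
have := fY w (lt_le_trans xY vw).
rewrite /= normrM normfV (gtr0_norm (g_gt0 w0)) ler_pdivrMr ?g_gt0//.
rewrite normrM ger0_norm ?sqr_ge0// => f2w.
have gw : g w <= kg * g x * (K * u ^+ 2).
  rewrite {1}wE (le_trans (g_submul u1 v1))//.
  apply: ler_pM => //; last exact: gK.
  - by rewrite mulr_ge0 ?g_ge0// ltW.
  - exact: g_ge0.
  by rewrite ler_pM2l// g_ndecr// xE ler_peMr ?ler1n// ltW.
have u20 : 0 < u ^+ 2 by rewrite exprn_gt0.
rewrite -(ler_pM2r u20).
have -> : `|derive1n 2 f w| * x ^+ 2 * u ^+ 2 =
    16 * (w ^+ 2 * `|derive1n 2 f w|).
  by rewrite xE wE; ring.
have -> : 32 * kg * K * g x * u ^+ 2 =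
    16 * (2 * (kg * g x * (K * u ^+ 2))) by ring.
by rewrite ler_pM2l// (le_trans f2w)// ler_pM2l.
Unshelve. all: by end_near. Qed.

(** * Bounds on the jump integrand *)

(** Integrable for the Levy measure; it dominates the jump integrand both for
    bounded and, after division by g, for large starting points. *)
Definition jump_weight (z : R * R) := Num.min 1 (enorm z ^+ 2) + f (enorm z).

Lemma jump_weight_ge0 z : 0 <= jump_weight z.
Proof. by rewrite addr_ge0// le_min ler01 sqr_ge0. Qed.

Lemma sqr_enorm_le_weight z : enorm z <= 1 -> enorm z ^+ 2 <= jump_weight z.
Proof.
move=> z1; rewrite /jump_weight (min_idPr _) ?lerDl//.
by rewrite expr_le1// enorm_ge0.
Qed.

(** Away from the origin the weight absorbs the constants in addition to f. *)
Lemma weight_away (r : R) z : r <= 1 -> 0 <= r <= enorm z ->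
  r ^+ 2 + f (enorm z) <= jump_weight z.
Proof.
move=> r1 /andP[r0 rz]; rewrite lerD2r le_min; apply/andP; split.
  by rewrite expr_le1.
by rewrite ler_sqr// nnegrE// enorm_ge0.
Qed.

Lemma weight_away_half z : 1 / 2 <= enorm z ->
  1 / 4 + f (enorm z) <= jump_weight z.
Proof.
move=> z2; have := @weight_away (1 / 2) z.
rewrite [(1 / 2) ^+ 2](_ : _ = 1 / 4); last by field.
by apply; [lra|apply/andP; split; lra].
Qed.

(** A Taylor expansion for |z| <= 1, the subadditivity of f for |z| > 1. *)
Lemma jump_bound_compact (M : R) : exists2 C, 0 < C & forall x z,
  `|x| <= M -> `|jump_integrand f x z| <= C * jump_weight z.
Proof.
have [B B0 fB] := bounded_on_segment (2 * M + 1) (C2_continuous2 C2f).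
have [n Mn] : exists n : nat, M <= n%:R.
  by exists (Num.trunc M).+1; rewrite ltW// truncnS_gt.
pose c1 := B * (M + 1) ^+ 2; pose c2 := kf + n.+1%:R * (kf + 1).
exists (`|c1| + c2); first by rewrite ltr_wpDl// addr_gt0// mulr_gt0// addr_gt0.
move=> x z xM; have w0 := jump_weight_ge0 z.
have M0 : 0 <= M := le_trans (normr_ge0 _) xM.
have h_le : `|x * z.1 + z.2| <= (M + 1) * enorm z.
  by rewrite (le_trans (displacement_le _ _))// ler_wpM2r ?enorm_ge0// lerD2r.
rewrite jump_integrandE; set h := x * z.1 + z.2 in h_le *.
have [z1|z1] := leP (enorm z) 1; rewrite ?mulr1 ?mulr0 ?subr0.
  apply: (@le_trans _ _ (B * h ^+ 2)).
    apply: taylor2_bound => // y yx; apply: fB.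
    have : `|h| <= M + 1.
      by rewrite (le_trans h_le)// ler_piMr// addr_ge0.
    have := ler_normD (y - x) x; rewrite subrK; lra.
  apply: (@le_trans _ _ (c1 * jump_weight z)); last first.
    rewrite ler_wpM2r// (le_trans (ler_norm _))// lerDl ltW// addr_gt0//.
    by rewrite mulr_gt0// addr_gt0.
  rewrite /c1 -mulrA ler_pM2l//.
  apply: (@le_trans _ _ ((M + 1) ^+ 2 * enorm z ^+ 2)); last first.
    by rewrite ler_wpM2l ?sqr_ge0// sqr_enorm_le_weight.
  rewrite -exprMn -(real_normK (num_real h)) ler_sqr// nnegrE.
  by rewrite mulr_ge0 ?enorm_ge0// addr_ge0.
apply: (@le_trans _ _ (c2 * jump_weight z)); last by rewrite ler_wpM2r// lerDr.
rewrite (le_trans (f_increment _ _))//.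
have h_le' : `|h| <= `|n.+1%:R * enorm z|.
  rewrite (ger0_norm (mulr_ge0 _ (enorm_ge0 z)))// (le_trans h_le)//.
  by rewrite ler_wpM2r ?enorm_ge0// -natr1 lerD2r.
have w1 : 1 + f (enorm z) <= jump_weight z.
  by have := @weight_away 1 z (lexx _); rewrite expr1n ler01 (ltW z1); exact.
have fz := f_ge0 (enorm z).
rewrite /c2 mulrDl lerD//.
  by rewrite ler_peMr ?(ltW kf_gt0)//; lra.
rewrite (le_trans (f_le_abs h_le'))// (le_trans (f_le_scale _ _))//.
rewrite -mulrA ler_wpM2l//.
have : 0 <= kf * (jump_weight z - 1).
  by rewrite mulr_ge0 ?(ltW kf_gt0)//; lra.
lra.
Qed.

(** For |z| <= 1 / 2 the point x + h stays at distance at least |x| / 4 from 0,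
    so the Taylor remainder is controlled by [f2_dilation_bound].  Otherwise
    |x + h| <= |x| * u with u = 1 + 2 * |z|, and [f_dilation_le] applies. *)
Lemma jump_bound_infty : exists2 C, 0 < C & \forall r \near +oo,
  forall x z, `|x| = r -> jump_integrand f x z <= C * g x * jump_weight z.
Proof.
have [B B0 fB] := f2_dilation_bound.
pose c1 := 9 / 4 * B; pose c2 := 6 + kg * (12 * kf + 2).
have c1_gt0 : 0 < c1 by rewrite mulr_gt0// divr_gt0.
have c2_gt0 : 0 < c2.
  by rewrite addr_gt0// mulr_gt0// addr_gt0// mulr_gt0.
exists (c1 + c2); first by rewrite addr_gt0.
near=> r => x z xr.
have r2 : 2 <= `|x|.
  by rewrite xr; near: r; apply: nbhs_pinfty_ge; exact: num_real.
have x_gt0 : 0 < `|x| by rewrite (lt_le_trans _ r2).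
have f2B y : `|x| / 4 <= `|y| -> `|derive1n 2 f y| * x ^+ 2 <= B * g x.
  by rewrite -(real_normK (num_real x)) -(g_abs x) xr; move: y; near: r.
have gx := g_ge0 x; have w0 := jump_weight_ge0 z.
have gw : 0 <= g x * jump_weight z by rewrite mulr_ge0.
have h_le : `|x * z.1 + z.2| <= 3 / 2 * `|x| * enorm z.
  rewrite (le_trans (displacement_le _ _))// ler_wpM2r ?enorm_ge0//.
  by move: r2; set a := `|x|; lra.
have E0 := enorm_ge0 z; have fE := f_ge0 (enorm z).
rewrite jump_integrandE; set h := x * z.1 + z.2 in h_le *.
have [z12|z12] := leP (enorm z) (1 / 2).
  have z1 : enorm z <= 1 by lra.
  rewrite z1 mulr1 (le_trans (ler_norm _))//.
  apply: (@le_trans _ _ ((B * g x / x ^+ 2) * h ^+ 2)).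
    apply: taylor2_bound => // y yx; rewrite ler_pdivlMr; last first.
      by rewrite -(real_normK (num_real x)) exprn_gt0.
    apply: f2B.
    have h34 : `|h| <= 3 / 4 * `|x|.
      rewrite (le_trans h_le)//.
      rewrite [leRHS](_ : _ = 3 / 2 * `|x| * (1 / 2)); last by field.
      by rewrite ler_wpM2l// mulr_ge0.
    have := ler_normD (x - y) y; rewrite subrK distrC.
    move: yx h34; lra.
  have x2 : 0 < x ^+ 2 by rewrite -(real_normK (num_real x)) exprn_gt0.
  have h2 : h ^+ 2 / x ^+ 2 <= 9 / 4 * jump_weight z.
    rewrite ler_pdivrMr//.
    apply: (@le_trans _ _ ((3 / 2 * `|x| * enorm z) ^+ 2)).
      rewrite -(real_normK (num_real h)) ler_sqr// nnegrE.
      by rewrite mulr_ge0// mulr_ge0.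
    rewrite [leLHS](_ : _ = 9 / 4 * (enorm z ^+ 2 * `|x| ^+ 2)); last by field.
    rewrite real_normK ?num_real// -[leRHS]mulrA ler_pM2l ?divr_gt0//.
    by rewrite ler_pM2r// sqr_enorm_le_weight.
  rewrite [leLHS](_ : _ = B * g x * (h ^+ 2 / x ^+ 2)); last by ring.
  have Bg : 0 <= B * g x by rewrite mulr_ge0// ltW.
  rewrite (le_trans (ler_wpM2l Bg h2))//.
  rewrite [leLHS](_ : _ = c1 * (g x * jump_weight z)); last first.
    by rewrite /c1; field.
  by rewrite -[leRHS]mulrA ler_wpM2r// lerDl ltW.
have w14 := weight_away_half (ltW z12).
have drift : - (derive1 f x * h * (enorm z <= 1)%R%:R) <=
    6 * (g x * jump_weight z).
  have [z1|z1] := leP (enorm z) 1; last by rewrite mulr0 oppr0 mulr_ge0.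
  rewrite mulr1 (le_trans (ler_norm _))// normrN normrM.
  have gE : g x = `|derive1 f x| * `|x|.
    by rewrite -(ger0_norm gx) normrM mulrC.
  apply: (@le_trans _ _ (`|derive1 f x| * (3 / 2 * `|x|))).
    rewrite ler_wpM2l// (le_trans h_le)// ler_piMr// mulr_ge0//.
  rewrite [leLHS](_ : _ = 6 * (g x * (1 / 4))); last by rewrite gE; field.
  by rewrite ler_pM2l// ler_wpM2l//; lra.
have incr : f (x + h) - f x <= kg * g x * ((12 * kf + 2) * jump_weight z).
  pose u := 1 + 2 * enorm z.
  have u1 : 1 <= u by rewrite /u; lra.
  have xu : `|x + h| <= `| `|x| * u|.
    rewrite (ger0_norm (mulr_ge0 _ _))//; last by rewrite /u; lra.
    rewrite (le_trans (ler_normD _ _))// mulrDr mulr1 lerD2l (le_trans h_le)//.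
    have : 0 <= `|x| * enorm z by rewrite mulr_ge0.
    lra.
  have := f_le_abs xu; have := f_dilation_le (le_trans (ler1n _ 2) r2) u1.
  rewrite f_abs g_abs => fd fxh.
  apply: (@le_trans _ _ (kg * g x * (f u - f 1))); first by lra.
  rewrite ler_wpM2l//; first by rewrite mulr_ge0// ltW.
  have := f_subadd 1 (2 * enorm z).
  have : f (2 * enorm z) <= 2 * (kf + f (enorm z)) := f_le_scale 1 _.
  have : 0 <= kf * (jump_weight z - 1 / 4).
    by rewrite mulr_ge0 ?(ltW kf_gt0)//; lra.
  have := kf_gt0; rewrite /u; lra.
rewrite /c2 [leRHS](_ : _ = c1 * (g x * jump_weight z) +
  (6 * (g x * jump_weight z) + kg * g x * ((12 * kf + 2) * jump_weight z)));
  last by ring.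
have : 0 <= c1 * (g x * jump_weight z) by rewrite mulr_ge0// ltW.
move: drift incr; lra.
Unshelve. all: by end_near. Qed.

Lemma measurable_enorm_f : measurable_fun setT (fun z : R * R => f (enorm z)).
Proof.
apply: measurableT_comp; last exact: measurable_enorm.
by apply: continuous_measurable_fun; exact: C2_continuous.
Qed.

Lemma measurable_jump (x : R) : measurable_fun setT (jump_integrand f x).
Proof.
have mh : measurable_fun setT (fun z : R * R => x * z.1 + z.2).
  by apply: measurable_funD => //; apply: measurable_funM.
have mball : measurable [set z : R * R | enorm z <= 1].
  rewrite (_ : mkset _ = @enorm R @^-1` `]-oo, 1]).
    by rewrite -[X in measurable X]setTI; exact: measurable_enorm.
  by apply/seteqP; split=> z /=; rewrite in_itv.
apply: measurable_funB.
  apply: measurable_funB => //.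
  apply: measurableT_comp.
    by apply: continuous_measurable_fun; exact: C2_continuous.
  by do 2 apply: measurable_funD => //; apply: measurable_funM.
by apply: measurable_funM => //; apply: measurable_funM.
Qed.

Lemma jump_scaled_cvg (a : nat -> R) z : slowly_varying g ->
  (forall n, a n != 0) -> `|a n| @[n --> \oo] --> +oo -> 1 + z.1 != 0 ->
  jump_integrand f (a n) z / g (a n) @[n --> \oo] --> jump_limit z.
Proof.
move=> g_sv aN0 aoo z1; have an0 n : 0 < `|a n| by rewrite normr_gt0.
have aV := div_cvg0 z.2 an0 aoo.
pose u n := `|1 + z.1 + z.2 / a n|.
have uz : u n @[n --> \oo] --> `|1 + z.1|.
  apply: cvg_norm; have := cvgD (cvg_cst (1 + z.1)) aV.
  by rewrite addr0; exact.
have z1_gt0 : 0 < `|1 + z.1| by rewrite normr_gt0.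
have fcvg : (f (`|a n| * u n) - f `|a n|) / g `|a n| @[n --> \oo] -->
    ln `|1 + z.1| by exact: f_dilation_cvg.
have dcvg : (z.1 + z.2 / a n) * (enorm z <= 1)%R%:R @[n --> \oo] -->
    z.1 * (enorm z <= 1)%R%:R.
  apply: cvgM; last exact: cvg_cst.
  by have := cvgD (cvg_cst z.1) aV; rewrite addr0; exact.
have -> : (fun n => jump_integrand f (a n) z / g (a n)) =
    (fun n => (f (`|a n| * u n) - f `|a n|) / g `|a n| -
      (z.1 + z.2 / a n) * (enorm z <= 1)%R%:R); last exact: (cvgB fcvg dcvg).
apply/funext => n.
have ga : g (a n) != 0 by rewrite -g_abs gt_eqF// g_gt0.
rewrite jump_integrandE; set i := (_ <= _)%R%:R.
have -> : a n + (a n * z.1 + z.2) = a n * (1 + z.1 + z.2 / a n).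
  by rewrite !mulrDr mulr1 [a n * (_ / _)]mulrC divfK// addrA.
rewrite -(f_abs (a n * _)) normrM -(f_abs (a n)) -(g_abs (a n)) /=.
rewrite mulrBl; congr (_ - _).
have /andP[_ f'a] : (a n != 0) && (derive1 f (a n) != 0).
  by rewrite -negb_or -mulf_eq0.
by rewrite g_abs /g; field; rewrite f'a aN0.
Qed.

(** Near 0, [log_jump] is quadratic; near -1, the logarithm is controlled by the
    negative power; elsewhere by f, thanks to [ln_le_f]. *)
Lemma log_jump_bound (e : R) : 0 < e -> exists2 C, 0 < C & forall z,
  `|log_jump z.1| <= C * (jump_weight z + near_minus1_weight e z).
Proof.
rewrite /log_jump => e0; have [C0 C0_gt0 lnC] := ln_le_f.
pose c1 := C0 * (4 * (1 + kf + f 1) + 1).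
have f1 := f_ge0 1; have k0 := kf_gt0.
have c1_gt0 : 0 < c1 by rewrite mulr_gt0//; lra.
have eV : 0 < e^-1 by rewrite invr_gt0.
exists (8 + c1 + e^-1); first by rewrite !addr_gt0.
move=> z; have w0 := jump_weight_ge0 z; have p0 := near_minus1_weight_ge0 e z.
set w := jump_weight z in w0 *; set p := near_minus1_weight e z in p0 *.
have cw : 0 <= c1 * w by rewrite mulr_ge0// ltW.
have cp : 0 <= c1 * p by rewrite mulr_ge0// ltW.
have ew : 0 <= e^-1 * w by rewrite mulr_ge0// ltW.
have ep : 0 <= e^-1 * p by rewrite mulr_ge0// ltW.
rewrite [leRHS](_ : _ = 8 * w + 8 * p + c1 * w + c1 * p + e^-1 * w + e^-1 * p);
  last by ring.
have [z12|z12] := leP `|z.1| (1 / 2).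
  have z1 : `|z.1| <= 1 by lra.
  rewrite z1 mulr1 (le_trans (norm_ln1D_sub_le z12))//.
  have : z.1 ^+ 2 <= w.
    rewrite -[leLHS]addr0 lerD// le_min; apply/andP; split.
      by rewrite -(real_normK (num_real _)) expr_le1.
    rewrite -(real_normK (num_real _)) ler_sqr ?fst_le_enorm//.
    by rewrite nnegrE enorm_ge0.
  lra.
have E12 : 1 / 2 <= enorm z by rewrite ltW// (lt_le_trans z12)// fst_le_enorm.
have w14 : 1 / 4 + f (enorm z) <= w := weight_away_half E12.
have fE := f_ge0 (enorm z).
have drift : `|z.1 * (`|z.1| <= 1)%R%:R| <= 4 * w.
  have [z1|z1] := leP `|z.1| 1; rewrite ?mulr1 ?mulr0 ?normr0; lra.
rewrite (le_trans (ler_normB _ _))//.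
have [v1|v1] := leP 1 `|1 + z.1|.
  have lnE : `|ln `|1 + z.1| | <= C0 * (1 + f (1 + enorm z)).
    rewrite (le_trans (lnC _ v1))// ler_pM2l// lerD2l f_le_abs//.
    rewrite normr_id [leRHS]ger0_norm ?addr_ge0 ?enorm_ge0//.
    by rewrite (le_trans (ler_normD _ _))// normr1 lerD2l fst_le_enorm.
  have : C0 * (1 + f (1 + enorm z)) <= c1 * w.
    rewrite /c1 -mulrA ler_pM2l//.
    have := f_subadd 1 (enorm z).
    have : 0 <= (1 + kf + f 1) * (w - 1 / 4) by rewrite mulr_ge0//; lra.
    lra.
  lra.
have [v12|v12] := leP (1 / 2) `|1 + z.1|.
  have v0 : 0 < `|1 + z.1| by lra.
  have : `|ln `|1 + z.1| | <= 1.
    rewrite ler0_norm; last by rewrite ln_le0// ltW.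
    rewrite -lnV ?posrE//.
    have := @le_ln1Dx _ (`|1 + z.1|^-1 - 1).
    rewrite [1 + (_ - 1)]addrC subrK => /(_ _)/wrap[|lnV1].
      by rewrite ltrDr invr_gt0.
    rewrite (le_trans lnV1)// lerBlDr -(@ler_pM2r _ `|1 + z.1|)// mulVf; lra.
  lra.
have := ln_near_minus1 e0 v12; rewrite -/p; lra.
Qed.

(** * Integrals against the Levy measure *)

Section levy_measure_integrals.
Variable tr : levy_triplet R.
Hypothesis tr_levy :
  (\int[nuUL tr]_z (Num.min 1 (enorm z ^+ 2))%:E < +oo)%E.
Hypothesis f_int : (\int[nuUL tr]_z (f (enorm z))%:E < +oo)%E.

Lemma integrable_jump_weight :
  (nuUL tr).-integrable setT (EFin \o jump_weight).
Proof.
apply: (@integrableD _ _ _ _ _ measurableT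
  (fun z => (Num.min 1 (enorm z ^+ 2))%:E) (fun z => (f (enorm z))%:E)).
  apply: ge0_integrable => //.
    apply: measurable_minr => //; apply: measurable_funX.
    exact: measurable_enorm.
  by move=> z; rewrite le_min ler01 sqr_ge0.
by apply: ge0_integrable => //; exact: measurable_enorm_f.
Qed.

Lemma integrable_jump (x : R) :
  (nuUL tr).-integrable setT (EFin \o jump_integrand f x).
Proof.
have [C C0 jC] := jump_bound_compact `|x|.
apply: (@integrable_le _ _ _ _ _ (fun z => C * jump_weight z)).
- exact: measurable_jump.
- by move=> z; exact: jC.
- exact: (integrableZl measurableT C integrable_jump_weight).
Qed.

Lemma jump_integral_bound (M : R) : exists2 C, 0 < C & forall x,
  `|x| <= M -> `|\int[nuUL tr]_z jump_integrand f x z| <= C.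
Proof.
have [C C0 jC] := jump_bound_compact M.
exists (C * \int[nuUL tr]_z jump_weight z + 1).
  rewrite ltr_wpDl// mulr_ge0 ?(ltW C0)//.
  by apply: Rintegral_ge0 => z _; exact: jump_weight_ge0.
move=> x xM; rewrite (le_trans (le_normr_Rintegral _ (integrable_jump x)))//.
rewrite ler_wpDr// -RintegralZl//; last exact: integrable_jump_weight.
apply: le_Rintegral => //.
- exact: (integrable_norm (integrable_jump x)).
- exact: (integrableZl measurableT C integrable_jump_weight).
- by move=> z _; exact: jC.
Qed.

Lemma integrable_near_minus1_weight (e : R) :
  (\int[nuU tr]_(z in `[(- (3 / 2))%R, (- (1 / 2))%R])
    (`|1 + z| `^ (- e))%:E < +oo)%E ->
  (nuUL tr).-integrable setT (EFin \o near_minus1_weight e).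
Proof.
move=> int_e.
have mP : measurable_fun setT (fun t : R => `|1 + t| `^ (- e)).
  apply: (@measurableT_comp _ _ _ _ _ _ (@powR R ^~ (- e))).
    exact: measurable_powR.
  by apply: measurableT_comp => //; apply: measurable_funD.
have mI : measurable (fst @^-1` `[(- (3 / 2))%R, (- (1 / 2))%R] : set (R * R)).
  by rewrite -[X in measurable X]setTI; exact: measurable_fst.
have -> : EFin \o near_minus1_weight e =
    (fun z => (`|1 + z.1| `^ (- e))%:E) \_
      (fst @^-1` `[(- (3 / 2))%R, (- (1 / 2))%R]).
  by rewrite -restrict_EFin.
apply: (integrable_mkcond _ mI).1; apply/integrableP; split.
  apply: measurable_funTS; apply/measurable_EFinP.
  by apply: (measurableT_comp mP); exact: measurable_fst.
under eq_integral do rewrite gee0_abs ?lee_fin ?powR_ge0//.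
move: int_e; rewrite /nuU integral_fst_marginal//; last exact/measurable_EFinP.
rewrite (_ : _ `&` _ = fst @^-1` `[(- (3 / 2))%R, (- (1 / 2))%R])//.
apply/seteqP; split=> z /=; rewrite in_itv/=; first by case.
move=> /andP[? z2]; split; last exact/andP.
by apply: contraTneq z2 => ->; rewrite -ltNge; lra.
Qed.

Lemma integrable_log_jump (e : R) : 0 < e ->
  (\int[nuU tr]_(z in `[(- (3 / 2))%R, (- (1 / 2))%R])
    (`|1 + z| `^ (- e))%:E < +oo)%E ->
  (nuUL tr).-integrable setT (EFin \o (fun z => log_jump z.1)).
Proof.
move=> e0 int_e; have [C C0 lC] := log_jump_bound e0.
apply: (@integrable_le _ _ _ _ _
  (fun z => C * (jump_weight z + near_minus1_weight e z))) => //.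
  apply: (@measurableT_comp _ _ _ _ _ _ (@log_jump R) setT fst).
    exact: measurable_log_jump.
  exact: measurable_fst.
exact: (integrableZl measurableT C (integrableD measurableT
  integrable_jump_weight (integrable_near_minus1_weight int_e))).
Qed.

Lemma integrable_oblique_jump :
  (nuUL tr).-integrable setT (EFin \o @oblique_jump R).
Proof.
apply: (integrable_le _ _ integrable_jump_weight).
  apply/(measurable_restrictT _ _).1; first exact: measurable_nu'_dom.
  by apply: measurable_funTS; exact: measurable_fst.
move=> z; rewrite /oblique_jump patchE; case: ifPn => [|_].
  rewrite inE/= in_itv/= -ler_norml => -[z1 Ez]; rewrite (le_trans z1)//.
  have := @weight_away 1 z (lexx _); rewrite expr1n ler01 (ltW Ez) => /(_ isT).
  by apply: le_trans; rewrite lerDl.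
by rewrite normr0 jump_weight_ge0.
Qed.

Lemma Rintegral_jump_limit (e : R) : 0 < e ->
  (\int[nuU tr]_(z in `[(- (3 / 2))%R, (- (1 / 2))%R])
    (`|1 + z| `^ (- e))%:E < +oo)%E ->
  (nuUL tr).-integrable setT (EFin \o @jump_limit R) /\
  \int[nuUL tr]_z jump_limit z =
    \int[nuU tr]_z (ln `|1 + z| - z * \1_[set y : R | `|y| <= 1] z)
    + \int[nu' tr]_(z in `[-1, 1]) z.
Proof.
move=> e0 int_e; have intl := integrable_log_jump e0 int_e.
have into := integrable_oblique_jump.
have jE : @jump_limit R = (fun z => log_jump z.1 + oblique_jump z).
  by apply/funext => z; exact: jump_limit_split.
rewrite jE; split; first exact: (integrableD measurableT intl into).
rewrite RintegralD//; congr (_ + _).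
  rewrite (_ : (fun z : R => ln `|1 + z| - _) = @log_jump R); last first.
    apply/funext => t; rewrite /log_jump indicE; congr (_ - _ * _%:R).
    by congr nat_of_bool; apply/idP/idP; rewrite inE.
  rewrite /Rintegral /nuU integral_fst_marginal//; last first.
    by apply/measurable_EFinP; exact: measurable_log_jump.
  rewrite [in RHS]integral_mkcond; congr fine; apply: eq_integral => z _.
  rewrite patchE; case: ifPn => //; rewrite notin_setE/= => /not_andP[|//].
  move=> /negP; rewrite negbK => /eqP ->.
  by rewrite /log_jump addr0 normr1 ln1 mul0r subrr.
rewrite /Rintegral /nu' integral_fst_marginal//.
rewrite [in RHS]integral_mkcond; congr fine; apply: eq_integral => z _.
rewrite /oblique_jump !patchE; do 2 case: ifPn => //.
- by rewrite notin_setE inE/= => zN [z1 z2]; case: zN.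
- by rewrite inE notin_setE/= => -[[? ?] ?] [].
Qed.

(** * The generator at infinity *)

Section drift_at_infinity.
Hypothesis g_sv : slowly_varying g.
Hypothesis nuU_m1 : nuU tr [set -1] = 0%E.
Hypothesis jump_limit_int : (nuUL tr).-integrable setT (EFin \o @jump_limit R).

Lemma first_jump_m1_null :
  measurable [set z : R * R | z.1 = -1] /\ nuUL tr [set z | z.1 = -1] = 0%E.
Proof.
split.
  rewrite (_ : mkset _ = fst @^-1` [set -1])//.
  by rewrite -[X in measurable X]setTI; exact: measurable_fst.
rewrite -nuU_m1 /nuU/= /fst_marginal /pushforward /mrestr; congr (nuUL tr _).
apply/seteqP; split=> z /=; last by case.
by move=> ->; split=> //; rewrite oppr_eq0 oner_eq0.
Qed.

Lemma generator_scaled x : 0 < g x -> generator tr f x / g x =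
  (gammaU tr + gammaL tr / x) +
  2^-1 * (sigmaU tr ^+ 2 + 2 * sigmaUL tr / x + sigmaL tr ^+ 2 / x ^+ 2)
    * (x ^+ 2 * derive1n 2 f x / g x)
  + \int[nuUL tr]_z (jump_integrand f x z / g x).
Proof.
move=> gx; have gN0 : g x != 0 by rewrite gt_eqF.
have /andP[x_neq0 f'x] : (x != 0) && (derive1 f x != 0).
  by rewrite -negb_or -mulf_eq0.
rewrite /generator !mulrDl; congr (_ + _ + _).
- by rewrite /g; field; rewrite f'x x_neq0.
- by move: (derive1n 2 f x) => f2; rewrite /g; field; rewrite f'x x_neq0.
- by rewrite RintegralZr//; exact: integrable_jump.
Qed.

(** By contradiction along a sequence a n with |a n| tending to infinity: were
    generator f (a n) > - c * g (a n) for every n, the scaled jump integrals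
    would stay above - c minus the scaled local part, and [reverse_fatou]
    would give a lower bound on the integral of [jump_limit]. *)
Lemma generator_le_infty (c : R) :
  gammaU tr - sigmaU tr ^+ 2 / 2 + \int[nuUL tr]_z jump_limit z < - c ->
  exists2 M, 0 < M & forall x, M < `|x| -> generator tr f x <= - c * g x.
Proof.
move=> kc; apply: contrapT => noM.
have [C C0 jC] := jump_bound_infty.
case: jC => X [_ jX]; pose X1 := `|X| + 1.
have X1_gt0 : 0 < X1 by rewrite ltr_wpDl.
have /choice[a aP] : forall n : nat, exists x : R,
    X1 + n%:R < `|x| /\ - c * g x < generator tr f x.
  move=> n; apply: contrapT => nx; apply: noM; exists (X1 + n%:R).
    by rewrite ltr_wpDr.
  move=> x xn; rewrite leNgt; apply/negP => cg; apply: nx; exists x; split=> //.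
have aX n : X1 < `|a n| by rewrite (le_lt_trans _ (aP n).1)// lerDl.
have a_gt0 n : 0 < `|a n| by rewrite (lt_trans X1_gt0).
have aN0 n : a n != 0 by rewrite -normr_gt0.
have ga n : 0 < g (a n) by rewrite -g_abs g_gt0.
have aoo : `|a n| @[n --> \oo] --> +oo.
  apply/cvgryPge => A; near=> n; rewrite (le_trans _ (ltW (aP n).1))//.
  rewrite ler_wpDl ?(ltW X1_gt0)//; near: n; exact: nbhs_infty_ger.
have invcvg k := div_cvg0 k a_gt0 aoo.
have f2cvg : a n ^+ 2 * derive1n 2 f (a n) / g (a n) @[n --> \oo] --> (-1 : R).
  have -> : (fun n => a n ^+ 2 * derive1n 2 f (a n) / g (a n)) =
      (fun n => `|a n| ^+ 2 * derive1n 2 f `|a n| / g `|a n|).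
    by apply/funext => n; rewrite real_normK ?num_real// derive2_abs g_abs.
  exact: (cvg_comp _ _ aoo f2_scaled_cvg).
pose dr n := (gammaU tr + gammaL tr / a n) +
  2^-1 * (sigmaU tr ^+ 2 + 2 * sigmaUL tr / a n + sigmaL tr ^+ 2 / a n ^+ 2)
    * (a n ^+ 2 * derive1n 2 f (a n) / g (a n)).
have drcvg : dr n @[n --> \oo] --> gammaU tr - sigmaU tr ^+ 2 / 2.
  have -> : gammaU tr - sigmaU tr ^+ 2 / 2 = (gammaU tr + 0) +
      2^-1 * (sigmaU tr ^+ 2 + 0 + sigmaL tr * 0 * (sigmaL tr * 0)) * -1.
    by field.
  have -> : dr = (fun n => (gammaU tr + gammaL tr / a n) +
      2^-1 * (sigmaU tr ^+ 2 + 2 * sigmaUL tr / a n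
        + sigmaL tr / a n * (sigmaL tr / a n))
      * (a n ^+ 2 * derive1n 2 f (a n) / g (a n))).
    apply/funext => n; rewrite /dr.
    by congr (_ + _ * (_ + _) * _); field.
  apply: cvgD; first by apply: cvgD; [exact: cvg_cst|exact: invcvg].
  apply: cvgM => //; apply: cvgM; first exact: cvg_cst.
  apply: cvgD; first by apply: cvgD; [exact: cvg_cst|exact: invcvg].
  by rewrite mulr0; apply: cvgM; exact: invcvg.
have [mN N0] := first_jump_m1_null.
suff h : - c - (gammaU tr - sigmaU tr ^+ 2 / 2) <= \int[nuUL tr]_z jump_limit z.
  by move: kc h; lra.
apply: (reverse_fatou (W := fun z => C * jump_weight z)
  (h := fun n z => jump_integrand f (a n) z / g (a n))
  (r := fun n => - c - dr n) mN N0 _ jump_limit_int).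
- exact: (integrableZl measurableT C integrable_jump_weight).
- move=> n.
  exact: (integrableZr measurableT (g (a n))^-1 (integrable_jump (a n))).
- move=> n z; rewrite ler_pdivrMr// mulrAC; apply: (jX `|a n|) => //.
  by rewrite (lt_trans _ (aX n))// /X1; have := ler_norm X; lra.
- move=> z zN; apply: jump_scaled_cvg => //.
  by apply/eqP => z1; apply: zN => /=; lra.
- move=> n; have := (aP n).2.
  rewrite -ltr_pdivlMr// generator_scaled// /dr; lra.
- by apply: cvgB => //; exact: cvg_cst.
Unshelve. all: by end_near. Qed.

End drift_at_infinity.

(** * The drift condition *)

Section drift_condition.
Hypothesis f_norm_like : norm_like f.
Variables (phi : R -> R) (c : R).
Hypothesis phi_concave : concave_function `[0, +oo[ phi.
Hypothesis phi_f : \forall x \near +oo, phi (f x) = g x.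
Hypothesis c_gt0 : 0 < c.

Lemma f_onto (x1 w : R) : 0 < x1 -> f x1 <= w -> exists2 t, x1 <= t & f t = w.
Proof.
move=> x1_gt0 fw; have [_ /cvgryPge/(_ w)[T [_ fT]] _] := f_norm_like.
pose S := Num.max x1 (T + 1).
have x1S : x1 <= S by rewrite le_max lexx.
have fS : w <= f S by apply: fT; rewrite /S lt_max ltrDl ltr01 orbT.
have cf : {within `[x1, S], continuous f}.
  exact/continuous_subspaceT/C2_continuous.
have [|t] := IVT x1S cf (v := w).
  by rewrite (min_idPl (le_trans fw fS)) (max_idPr (le_trans fw fS)) fw fS.
by rewrite in_itv/= => /andP[x1t _] ft; exists t.
Qed.

(** phi is only known on the range of f near infinity, hence the translation by
    K: f takes every value above K - 1 at points where phi (f x) = g x, which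
    gives the positivity and the local bounds, and [concave_double] compares
    phi (f x + K) with phi (f x). *)
Lemma phi_positive_translate : exists2 K, 1 <= K &
  [/\ forall u, K <= u -> 0 < phi u,
      forall B, exists G, forall u, K <= u <= B -> phi u <= G &
      \forall r \near +oo, forall x, `|x| = r -> phi (f x + K) <= 2 * g x].
Proof.
have [X [_ fX]] := phi_f.
pose x1 := Num.max X x0 + 1.
have [Xx1 x0x1] : X < x1 /\ x0 < x1.
  by split; rewrite (@le_lt_trans _ _ (Num.max X x0)) ?ltrDl//
    le_max lexx ?orbT.
have x1_gt0 : 0 < x1 by rewrite (lt_trans x0_gt0).
have phi_pos u : f x1 <= u -> 0 < phi u.
  move=> /(f_onto x1_gt0)[t x1t <-].
  by rewrite fX ?(lt_le_trans Xx1)// g_gt0// (lt_le_trans x1_gt0).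
have f1 := f_ge0 x1.
exists (f x1 + 1); first by rewrite lerDr.
split => [u xu|B|]; first by rewrite phi_pos//; lra.
  have [|T x1T fT] := @f_onto x1 (Num.max B (f x1) + 1) x1_gt0.
    by rewrite ler_wpDr// le_max lexx orbT.
  exists (g T) => u /andP[xu]; have {xu} : f x1 <= u by lra.
  move=> /(f_onto x1_gt0)[t x1t <-] tB.
  rewrite fX ?(lt_le_trans Xx1)// g_ndecr ?(lt_le_trans x0x1)//.
  rewrite leNgt; apply/negP => Tt.
  have T0 : 0 < T by rewrite (lt_le_trans x1_gt0).
  have : f T <= f t by apply: f_le_abs; rewrite !gtr0_norm ?ltW// (lt_trans T0).
  rewrite fT leNgt (le_lt_trans tB)//.
  by rewrite (@le_lt_trans _ _ (Num.max B (f x1))) ?ltrDl// le_max lexx.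
have [_ fy _] := f_norm_like.
near=> r => x xr; rewrite -f_abs -g_abs xr -fX; last first.
  by near: r; apply: nbhs_pinfty_gt; exact: num_real.
have fr : 2 * f x1 + 1 <= f r by near: r; move/cvgryPge: fy; exact.
apply: concave_double => //; first by apply/andP; split; lra.
by rewrite ltW// phi_pos; lra.
Unshelve. all: by end_near. Qed.

Lemma local_generator_continuous :
  continuous (fun x : R => (x * gammaU tr + gammaL tr) * derive1 f x
    + 2^-1 * (x ^+ 2 * sigmaU tr ^+ 2 + 2 * x * sigmaUL tr + sigmaL tr ^+ 2)
      * derive1n 2 f x).
Proof.
move=> x.
have ck (k : R) : (fun=> k) y @[y --> x] --> k by exact: cvg_cst.
have c1 : derive1 f y @[y --> x] --> derive1 f x by exact: C2_continuous1.
have c2 : derive1n 2 f y @[y --> x] --> derive1n 2 f x by exact: C2_continuous2.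
have cX2 : y ^+ 2 @[y --> x] --> x ^+ 2 by apply: exprn_continuous.
apply: cvgD.
  by apply: cvgM c1; apply: cvgD (ck _); apply: cvgM (ck _); exact: cvg_id.
apply: cvgM c2; apply: cvgM; first exact: ck.
apply: cvgD (ck _); apply: cvgD; first exact: cvgM cX2 (ck _).
by apply: cvgM (ck _); apply: cvgM; [exact: ck|exact: cvg_id].
Qed.

(** F = f + 1 and Phi u = c / 2 * phi (u + K - 1), so that Phi (F x) is
    c / 2 * phi (f x + K), at most c * g x for large |x|. *)
Lemma drift_condition_of_generator_bound :
  (exists2 M, 0 < M & forall x, M < `|x| -> generator tr f x <= - c * g x) ->
  subexponential_drift_condition tr.
Proof.
move=> [M M0 genM].
have [K K0 [phi_pos phi_bnd [X [_ phiX]]]] := phi_positive_translate.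
pose N := Num.max M `|X| + 1.
have MN : M < N.
  by rewrite (@le_lt_trans _ _ (Num.max M `|X|)) ?ltrDl// le_max lexx.
have XN : X < N.
  rewrite (le_lt_trans (ler_norm _))//.
  by rewrite (@le_lt_trans _ _ (Num.max M `|X|)) ?ltrDl// le_max lexx orbT.
have [J J0 genJ] := jump_integral_bound N.
have [B B0 genB] := bounded_on_segment N local_generator_continuous.
have [G phiG] := phi_bnd (f N + K).
have K1 : 0 <= K - 1 by lra.
have c2_gt0 : 0 < c / 2 by rewrite divr_gt0.
exists (fun x => f x + 1), (fun u => c / 2 * phi (u + (K - 1))),
  (B + J + c / 2 * `|G| + 1), `[- N, N]%classic; split.
- by split; [exact: norm_like_addc|move=> x; rewrite lerDr].
- split; first exact: C2_addc.
  by rewrite jump_integrand_addc//; exact: integrable_jump.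
- split; last exact: segment_compact.
  have : 0 <= c / 2 * `|G| by rewrite mulr_ge0// ltW.
  lra.
- split; first by move=> u u1; rewrite mulr_gt0// phi_pos//; lra.
  by apply: concave_translate => //; exact: ltW.
move=> x; rewrite generator_addc//.
rewrite (_ : f x + 1 + (K - 1) = f x + K); last by ring.
rewrite indicE; have [xN|xN] := leP `|x| N; last first.
  rewrite memNset/=; last by rewrite in_itv/= -ler_norml leNgt xN.
  rewrite mulr0 addr0 (le_trans (genM x (lt_trans MN xN)))//.
  rewrite mulNr lerN2.
  have hx : phi (f x + K) <= 2 * g x by exact: (phiX _ (lt_trans XN xN)).
  by rewrite (_ : c * g x = c / 2 * (2 * g x)) ?ler_pM2l//; field.
rewrite mem_set/=; last by rewrite in_itv/= -ler_norml.
have phix : c / 2 * phi (f x + K) <= c / 2 * `|G|.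
  rewrite ler_pM2l// (le_trans _ (ler_norm G))// phiG// lerDr f_ge0/= lerD2r.
  by apply: f_le_abs; rewrite (le_trans xN)// ler_norm.
apply: (@le_trans _ _ (B + J)); last by move: phix; lra.
by apply: lerD; apply: le_trans (ler_norm _) _; [exact: genB|exact: genJ].
Qed.

End drift_condition.

End levy_measure_integrals.
End logarithmic_growth.

Theorem proposition8 (R : realType) (d : measure_display)
    (T : measurableType d) (P : probability T R) (U L : R -> T -> R)
    (tr : levy_triplet R) (f g : R -> R) :
  levy_process_with_triplet P U L tr ->
  nuU tr [set -1] = 0%E ->
  norm_like f ->
  C2 f ->
  (forall x, f (- x) = f x) ->
  (exists2 kf : R, 0 < kf & forall x y, f (x + y) <= kf + f x + f y) ->
  (x%:E * ereal_sup [set `|derive1n 2 f y|%:E | y in [set y | (x <= `|y|)%R]])%E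
    @[x --> +oo] --> 0%E ->
  derive1 f x @[x --> +oo] --> 0 ->
  (\int[nuUL tr]_z (f (enorm z))%:E < +oo)%E ->
  (forall x, g x = x * derive1 f x) ->
  (forall x, 0 < x -> 0 < g x) ->
  slowly_varying g ->
  (exists2 x0 : R, 0 < x0 & forall x y, x0 < x -> x <= y -> g x <= g y) ->
  (exists2 kg : R, 0 < kg &
    forall u x, 1 <= u -> 1 <= x -> g (x * u) <= kg * g x * g u) ->
  asymp_eq (fun x => x * derive1n 2 f x) (fun x => - derive1 f x) ->
  (exists2 phi : R -> R, concave_function `[0, +oo[ phi &
    \forall x \near +oo, phi (f x) = g x) ->
  (\int[nuU tr]_(z in [set z : R | (1 < `|z|)%R]) (g z * ln `|z|)%:E < +oo)%E ->
  (exists2 eps : R, 0 < eps &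
    (\int[nuU tr]_(z in `[(- (3 / 2))%R, (- (1 / 2))%R])
       (`|1 + z| `^ (- eps))%:E < +oo)%E) ->
  gammaU tr - sigmaU tr ^+ 2 / 2
    + \int[nuU tr]_z (ln `|1 + z| - z * \1_[set y : R | `|y| <= 1] z)
    + \int[nu' tr]_(z in `[-1, 1]) z < 0 ->
  subexponential_drift_condition tr.
Proof.
move=> [[_ [_ nu_min]] _ _] nuU1 fnl C2f f_even [kf kf0 f_sub] _ f'0 f_int gE.
have -> : g = (fun x => x * derive1 f x) by apply/funext.
move=> g0 g_sv [x0 x0_gt0 g_mono] [kg kg0 g_sub] f'a [phi phi_c phi_f] _.
move=> [e e0 int_e] k_lt0.
have f_ge0 : forall x, 0 <= f x by case: fnl.
have [int_l intE] := Rintegral_jump_limit f_ge0 C2f kf0 f_even f_sub g0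
  x0_gt0 g_mono nu_min f_int e0 int_e.
rewrite -addrA -intE in k_lt0.
set k := (X in X < 0) in k_lt0.
have c_gt0 : 0 < - k / 2 by rewrite divr_gt0// oppr_gt0.
apply: (drift_condition_of_generator_bound f_ge0 C2f kf0 f_even f_sub g0
  x0_gt0 g_mono nu_min f_int fnl phi_c phi_f c_gt0).
apply: (generator_le_infty f_ge0 C2f kf0 f_even f_sub g0 g_sub g_mono f'a
  kg0 f'0 nu_min f_int g_sv nuU1 int_l).
by rewrite -/k; lra.
Qed.
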